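(* Let $f,g:\mathbb{R}\to\mathbb{R}$ be two polynomial functions of the same degree $d\geq 1$ having the same number $p\geq 2$ of critical points. Then $f$ and $g$ are Lipschitz equivalent if and only if their multiplicity symbols are similar.
   Context: Two nonzero polynomial functions $f,g:\mathbb{R}\to\mathbb{R}$ are Lipschitz equivalent, written $f\cong g$, if there exist a bi-Lipschitz homeomorphism $\phi:\mathbb{R}\to\mathbb{R}$ and a constant $c>0$ such that $g\circ\phi=cf$. Critical points are real points where the derivative vanishes. The multiplicity of a nonconstant polynomial function $f$ at $t_0\in\mathbb{R}$ is the order of vanishing of $f(t)-f(t_0)$ at $t=t_0$. Let $f$ be a polynomial function of degree $d\ge 1$ with exactly $p\geq 2$ critical points $t_1<\dots<t_p$, with multiplicities $\mu_1,\dots,\mu_p$ respectively. The multiplicity symbol of $f$ is the ordered pair $(a,\mu)$ with $a=(f(t_1),\dots,f(t_p))$ and $\mu=(\mu_1,\dots,\mu_p)$. For a $p$-tuple $x=(x_1,\dots,x_p)$, write $\overline{x}=(x_p,\dots,x_1)$. Two multiplicity symbols $(a,\mu)$ and $(b,\nu)$ (with the same $p$) are directly similar if there is a constant $c>0$ with $b=c\cdot a$, and $\nu=\mu$; they are reversely similar if there is a constant $c>0$ with $b=c\cdot\overline{a}$, and $\nu=\overline{\mu}$. They are similar if they are either directly similar or reversely similar. *)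

(* Defs.v *)
From HB Require Import structures.
From mathcomp Require Import all_boot all_order all_algebra.
From mathcomp Require Import all_classical all_reals all_analysis.

Set Implicit Arguments.
Unset Strict Implicit.
Unset Printing Implicit Defensive.

Import Order.TTheory GRing.Theory Num.Theory.
Import numFieldNormedType.Exports.

Local Open Scope classical_set_scope.
Local Open Scope ring_scope.

(* Continuity of [phi] and of its inverse [psi] follows from the Lipschitz
   conditions, so such a [phi] is a homeomorphism of the line. *)
Definition bilipschitz_homeo (R : realType) (phi : R -> R) : Prop :=
  exists psi : R -> R,
    [/\ cancel phi psi, cancel psi phi, lipschitz phi & lipschitz psi].

Definition lipschitz_equiv (R : realType) (f g : R -> R) : Prop :=
  exists2 phi : R -> R, bilipschitz_homeo phi &
    exists2 c : R, 0 < c & forall x, g (phi x) = c * f x.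

(* [t] lists all the critical points of [f], in strictly increasing order. *)
Definition critical_points (R : realType) (p : nat) (f : {poly R})
    (t : p.-tuple R) : Prop :=
  sorted <%R t /\ forall x : R, x \in t <-> f^`().[x] = 0.

(* [mup x q] is only meaningful for [q != 0], i.e. here for nonconstant [f]. *)
Definition multiplicity (R : realType) (f : {poly R}) (t0 : R) : nat :=
  mup t0 (f - (f.[t0])%:P).

Definition mult_symbol (R : realType) (p : nat) (f : {poly R})
    (t : p.-tuple R) : p.-tuple R * p.-tuple nat :=
  ([tuple of map (horner f) t], [tuple of map (multiplicity f) t]).

Definition directly_similar (R : realType) (p : nat)
    (S T : p.-tuple R * p.-tuple nat) : Prop :=
  (exists2 c : R, 0 < c & T.1 = [tuple of map ( *%R c) S.1]) /\ T.2 = S.2.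

Definition reversely_similar (R : realType) (p : nat)
    (S T : p.-tuple R * p.-tuple nat) : Prop :=
  (exists2 c : R, 0 < c & T.1 = [tuple of map ( *%R c) (rev S.1)]) /\
  T.2 = [tuple of rev S.2].

Definition symbols_similar (R : realType) (p : nat)
    (S T : p.-tuple R * p.-tuple nat) : Prop :=
  directly_similar S T \/ reversely_similar S T.

(* Main.v *)
From mathcomp Require Import polyorder polyrcf.
Require Import Defs.
From mathcomp Require Import all_boot all_order all_algebra.
From mathcomp Require Import all_classical all_reals all_analysis.
From mathcomp Require Import ring lra.
Import numFieldNormedType.Exports.
Import Order.TTheory GRing.Theory Num.Theory.
Local Open Scope ring_scope.

Set Implicit Arguments.
Unset Strict Implicit.
Unset Printing Implicit Defensive.

(** Let [phi] be bi-Lipschitz with [g (phi x) = c f x].  Near [x], the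
    difference [f y - f x] has the size of [|y - x| ^ m], where [m] is the
    multiplicity of [f] at [x], and distances are preserved by [phi] up to
    bounded factors; so [g] has the same multiplicity at [phi x]
    ([multiplicity_bilipschitz]).  The critical points are the points of
    multiplicity at least 2, hence [phi] maps those of [f] onto those of [g].
    Being monotone, it does so in order or in reverse order
    ([bilipschitz_critical]), and the symbols are similar.

    Conversely, replacing [f] by [c f], and by [f (- x)] if the symbols are
    reversely similar, one may suppose that both polynomials have the same
    symbol.  Then [f'] is the product of the [(X - t_i) ^ (mu_i - 1)] and of a
    polynomial without real roots, and similarly for [g'], so on corresponding
    intervals between critical points the signs of [f'] and [g'] agree up to one
    global sign; that sign is [+] because [f] and [g] have the same increment
    between their first two critical points ([direct_matched]; this is where
    two critical points are needed).  So for each [x] there is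
    exactly one [y] in the interval corresponding to that of [x] such that
    [g y = f x] ([corresponds_exists], [corresponds_inj]), and [x |-> y] is an
    increasing bijection [phi].

    Since the construction is symmetric in [f] and [g], it remains to see that
    [phi] is Lipschitz.  Away from the critical points its derivative is
    [f' x / g' (phi x)], so it suffices to bound [|f' x|] by a multiple of
    [|g' (phi x)|] ([deriv_le_of_corresponds]).  This follows factor by factor
    from [|x - t_i| <= K |phi x - s_i|] ([dist_critical_le]) and
    [1 + |x| <= K (1 + |phi x|)] ([growth_le_of_conj]): the first holds near
    [t_i] because the multiplicities agree, the second because the degrees
    agree, and the monotonicity of [phi] covers the range in between. *)

(** * Growth and local size of polynomials *)

Section PolynomialBounds.
Variable R : realType.
Implicit Types (p f g : {poly R}) (x y : R).

Lemma horner_upper p :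
  exists2 C, 0 < C & forall x, `|p.[x]| <= C * (1 + `|x|) ^+ (size p).-1.
Proof.
exists (1 + \sum_(i < size p) `|p`_i|) => [|x].
  by rewrite ltr_pwDl ?sumr_ge0.
rewrite horner_coef mulrDl mul1r.
apply: le_trans (ler_norm_sum _ _ _) _.
rewrite ler_wpDl ?exprn_ge0 ?addr_ge0// mulr_suml ler_sum// => i _.
rewrite normrM normrX ler_wpM2l//.
apply: (@le_trans _ _ ((1 + `|x|) ^+ i)).
  by rewrite lerXn2r ?nnegrE ?addr_ge0// lerDr.
by rewrite ler_weXn2l ?lerDl// -ltnS prednK//; case: (size p) i => [[]|].
Qed.

Lemma horner_lower p : p != 0 ->
  exists2 c, 0 < c & exists M, forall x, M <= `|x| ->
    c * (1 + `|x|) ^+ (size p).-1 <= `|p.[x]|.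
Proof.
elim/poly_ind: p => [|q a IH]; first by rewrite eqxx.
have [->|q0 _] := eqVneq q 0.
  rewrite mul0r add0r polyC_eq0 => a0; exists `|a|; first by rewrite normr_gt0.
  by exists 0 => x _; rewrite size_polyC a0 expr0 mulr1 hornerC.
have [c c0 [M qM]] := IH q0.
have sq : (size q = (size q).-1.+1)%N by rewrite prednK// size_poly_gt0.
exists (c / 4); first by rewrite divr_gt0.
exists (Num.max M (Num.max 1 (4 * `|a| / c))) => x.
rewrite !ge_max => /and3P[/qM {}qM x1 xa].
have -> : (size (q * 'X + a%:P)).-1 = size q by rewrite size_MXaddC (negPf q0).
rewrite hornerMXaddC.
have e1 : 1 <= (1 + `|x|) ^+ (size q).-1 by rewrite exprn_ege1// lerDl.
rewrite sq exprS; move: qM e1; set e := (1 + `|x|) ^+ _ => qM e1.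
have : `|q.[x]| * `|x| - `|a| <= `|q.[x] * x + a|.
  by rewrite -normrM -[`|a|]normrN (le_trans (lerB_dist _ _))// opprK.
apply: le_trans.
have h1 : c * e * `|x| <= `|q.[x]| * `|x| by rewrite ler_wpM2r.
have h2 : 4 * `|a| <= c * `|x| by rewrite [c * _]mulrC -ler_pdivrMr.
have h3 : c * `|x| <= c * `|x| * e by rewrite ler_peMr// mulr_ge0// ltW.
have h4 : c * e <= c * e * `|x| by rewrite ler_peMr// mulr_ge0// ?ltW// (lt_le_trans _ e1).
nra.
Qed.

(** At infinity this is [horner_lower]; on a compact interval [|p|] has a
    positive minimum. *)
Lemma rootless_lower p : (forall x, p.[x] != 0) ->
  exists2 c, 0 < c & forall x, c * (1 + `|x|) ^+ (size p).-1 <= `|p.[x]|.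
Proof.
move=> p0; have pN0 : p != 0 by apply: contraNneq (p0 0) => ->; rewrite horner0.
have [c c0 [M pM]] := horner_lower pN0; set e := (size p).-1 in pM *.
set N := Num.max M 0.
have N0 : 0 <= N by rewrite le_max lexx orbT.
have cont : {within `[- N, N]%classic, continuous (fun x => `|p.[x]|)}%classic.
  apply: continuous_subspaceT => x; apply: continuous_comp; first exact: continuous_horner.
  exact: norm_continuous.
have [|z _ zmin] := EVT_min _ cont; first by rewrite ge0_cp.
have E0 : 0 < (1 + N) ^+ e by rewrite exprn_gt0// ltr_pwDl.
exists (Num.min c (`|p.[z]| / (1 + N) ^+ e)).
  by rewrite lt_min c0 divr_gt0// normr_gt0.
move=> x; have E1 : 0 <= (1 + `|x|) ^+ e by rewrite exprn_ge0// addr_ge0.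
have [Nx|xN] := leP N `|x|.
  have /pM : M <= `|x| by apply: le_trans Nx; rewrite le_max lexx.
  by apply: le_trans; rewrite ler_wpM2r// ge_min lexx.
have xN' : x \in `[- N, N] by rewrite in_itv/= -ler_norml ltW.
apply: le_trans (zmin _ xN').
rewrite (@le_trans _ _ (`|p.[z]| / (1 + N) ^+ e * (1 + `|x|) ^+ e))//.
  by rewrite ler_wpM2r// ge_min lexx orbT.
rewrite mulrAC ler_pdivrMr// ler_wpM2l//.
by rewrite lerXn2r ?nnegrE ?addr_ge0// lerD2l ltW.
Qed.

Lemma horner_bounded_near p a :
  exists2 C, 0 < C & forall x, `|x - a| <= 1 -> `|p.[x]| <= C.
Proof.
have [C C0 pC] := horner_upper p.
exists (C * (2 + `|a|) ^+ (size p).-1) => [|x xa].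
  by rewrite mulr_gt0// exprn_gt0// ltr_pwDl.
apply: le_trans (pC x) _; rewrite ler_wpM2l// ?(ltW C0)//.
rewrite lerXn2r ?nnegrE ?addr_ge0//.
have : `|x| <= `|x - a| + `|a| by rewrite -{1}[x](subrK a) ler_normD.
lra.
Qed.

Lemma horner_away_near p a : p.[a] != 0 ->
  exists2 d, 0 < d & forall x, `|x - a| < d -> `|p.[a]| / 2 <= `|p.[x]|.
Proof.
move=> pa; have e0 : 0 < `|p.[a]| / 2 by rewrite divr_gt0// normr_gt0.
have [d d0 pd] := poly_cont a p e0.
exists d => // x /pd h.
have : `|p.[a]| <= `|p.[a] - p.[x]| + `|p.[x]|.
  by rewrite -{1}[p.[a]](subrK p.[x]) ler_normD.
rewrite distrC; lra.
Qed.

Lemma multiplicityP f x : (1 < size f)%N ->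
  exists2 u : {poly R}, u.[x] != 0 &
    f - (f.[x])%:P = u * ('X - x%:P) ^+ multiplicity f x.
Proof.
move=> sf; have nz : f - (f.[x])%:P != 0.
  by rewrite subr_eq0; apply: contraTneq sf => ->; rewrite size_polyC -leqNgt leq_b1.
have [m [u]] := multiplicity_XsubC (f - (f.[x])%:P) x.
rewrite nz /= => ux e; exists u; first exact: ux.
by rewrite /multiplicity {2}e mupMr// mup_XsubCX eqxx.
Qed.

Lemma multiplicity_horner f x : (1 < size f)%N ->
  exists2 u : {poly R}, u.[x] != 0 &
    forall y, f.[y] - f.[x] = u.[y] * (y - x) ^+ multiplicity f x.
Proof.
move=> /(multiplicityP x)[u ux e]; exists u => // y.
by move/(congr1 (horner^~ y)): e; rewrite !hornerE.
Qed.

Lemma deriv_neq0 f : (1 < size f)%N -> f^`() != 0.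
Proof.
by move=> sf; rewrite -size_poly_eq0 size_deriv; case: (size f) sf => [|[]].
Qed.

(** Multiplicities drop by exactly one under derivation because the
    coefficients have characteristic 0. *)
Lemma multiplicity_deriv f x : (1 < size f)%N ->
  multiplicity f x = (mup x f^`()).+1.
Proof.
move=> sf; have [u ux e] := multiplicityP x sf.
case: (multiplicity f x) e => [|m] e.
  move/(congr1 (horner^~ x)): e ux; rewrite !hornerE subrr => <-.
  by rewrite eqxx.
have -> : f^`() = (u^`() * ('X - x%:P) + u *+ m.+1) * ('X - x%:P) ^+ m.
  have -> : f^`() = (f - (f.[x])%:P)^`() by rewrite derivB derivC subr0.
  rewrite e derivM deriv_exp derivXsubC mul1r /= mulrDl -mulrA -exprS.
  by rewrite mulrnAl mulrnAr.
rewrite mupMr ?mup_XsubCX ?eqxx//.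
by rewrite rootE hornerD hornerM hornerXsubC subrr mulr0 add0r hornerMn mulrn_eq0.
Qed.

Lemma critical_multiplicity f x : (1 < size f)%N ->
  (f^`().[x] == 0) = (1 < multiplicity f x)%N.
Proof.
move=> sf; rewrite multiplicity_deriv// ltnS -XsubC_dvd ?deriv_neq0//.
by rewrite dvdp_XsubCl.
Qed.

End PolynomialBounds.

(** * Multiplicities under bi-Lipschitz maps *)

Section LipschitzHomeo.
Variable R : realType.
Implicit Types (f g : {poly R}) (phi psi : R -> R).

Lemma lipschitzP phi :
  lipschitz phi <-> exists L, forall x y, `|phi x - phi y| <= L * `|x - y|.
Proof.
split.
  rewrite /lipschitz_on /= => -[M [Mr H]]; exists (M + 1) => x y.
  have := H (M + 1); rewrite ltrDl ltr01 => /(_ isT (x, y)) /=; exact.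
move=> [L HL]; apply: (@klipschitzW _ _ _ L).
  exact: (@globally_properfilter _ _ (0, 0)).
by move=> [x y] _ /=; exact: HL.
Qed.

Lemma lipschitz_gt0P phi : lipschitz phi ->
  exists2 L, 0 < L & forall x y, `|phi x - phi y| <= L * `|x - y|.
Proof.
move=> /lipschitzP[L HL]; exists (1 + `|L|); first by rewrite ltr_pwDl.
move=> x y; apply: le_trans (HL x y) _; rewrite ler_wpM2r//.
by rewrite (le_trans (ler_norm L))// lerDr.
Qed.

Lemma lipschitz_continuous phi : lipschitz phi -> continuous phi.
Proof.
move=> /lipschitz_gt0P[L L0 HL] x; apply/cvgrPdist_lt => e e0.
near=> y; apply: le_lt_trans (HL x y) _; rewrite mulrC -ltr_pdivlMr//.
near: y; apply: cvgr_dist_lt => //; exact: divr_gt0.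
Unshelve. all: by end_near. Qed.

Lemma lipschitz_comp phi psi :
  lipschitz phi -> lipschitz psi -> lipschitz (phi \o psi).
Proof.
move=> /lipschitz_gt0P[L L0 HL] /lipschitz_gt0P[K _ HK]; apply/lipschitzP.
exists (L * K) => x y; apply: le_trans (HL _ _) _.
by rewrite -mulrA ler_wpM2l// ltW.
Qed.

Lemma bilipschitz_comp phi psi : bilipschitz_homeo phi ->
  bilipschitz_homeo psi -> bilipschitz_homeo (phi \o psi).
Proof.
move=> [phi' [c1 c2 l1 l2]] [psi' [k1 k2 m1 m2]]; exists (psi' \o phi'); split.
- exact: can_comp.
- exact: can_comp.
- exact: lipschitz_comp.
- exact: lipschitz_comp.
Qed.

Lemma bilipschitz_opp : bilipschitz_homeo (-%R : R -> R).
Proof.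
have l : lipschitz (-%R : R -> R).
  by apply/lipschitzP; exists 1 => x y; rewrite mul1r -opprD normrN.
by exists -%R; split => //; exact: opprK.
Qed.

(** Only the upper Lipschitz bound on [phi] is needed for this inequality:
    [g (phi y) - g (phi x)] is at most of order [|y - x| ^ n], where [n] is the
    multiplicity of [g], whereas [f y - f x] is exactly of order
    [|y - x| ^ m].  The reverse inequality comes from the inverse of [phi]. *)
Lemma multiplicity_lipschitz_le f g phi c x :
  (1 < size f)%N -> (1 < size g)%N -> lipschitz phi -> c != 0 ->
  (forall y, g.[phi y] = c * f.[y]) ->
  (multiplicity g (phi x) <= multiplicity f x)%N.
Proof.
move=> sf sg /lipschitz_gt0P[L L0 HL] c0 gphi.
have [u ux fu] := multiplicity_horner x sf.
have [v vx gv] := multiplicity_horner (phi x) sg.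
set m := multiplicity f x in fu *; set n := multiplicity g _ in gv *.
rewrite leqNgt; apply/negP => mn.
have [C C0 vC] := horner_bounded_near v (phi x).
have [d d0 ud] := horner_away_near ux.
have A0 : 0 < `|c| * (`|u.[x]| / 2) by rewrite mulr_gt0 ?normr_gt0 ?divr_gt0 ?normr_gt0.
set A := `|c| * _ in A0.
have B0 : 0 < C * L ^+ n by rewrite mulr_gt0// exprn_gt0.
set B := C * _ in B0.
(* If [m < n], letting [h] tend to 0 below contradicts [0 < A]. *)
have key h : 0 < h -> h < d -> h <= 1 -> L * h <= 1 -> A <= B * h ^+ (n - m).
  move=> h0 hd h1 Lh; have hx : `|x + h - x| = h by rewrite addrC addKr gtr0_norm.
  have p1 : `|phi (x + h) - phi x| <= L * h by rewrite -{2}hx.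
  have := gv (phi (x + h)); rewrite !gphi -mulrBr fu => /(congr1 Num.norm).
  rewrite !normrM !normrX hx => e.
  have e1 : A * h ^+ m <= B * h ^+ n.
    apply: (@le_trans _ _ (`|c| * (`|u.[x + h]| * h ^+ m))).
      rewrite /A -mulrA ler_wpM2l// ler_wpM2r ?exprn_ge0 ?(ltW h0)//.
      by apply: ud; rewrite hx.
    rewrite e /B -mulrA -exprMn ler_pM ?exprn_ge0// ?vC ?(le_trans p1)//.
    by rewrite lerXn2r ?nnegrE// mulr_ge0 ?(ltW L0) ?(ltW h0).
  by move: e1; rewrite -{1}(subnK (ltnW mn)) exprD mulrA ler_pM2r ?exprn_gt0.
pose h := Num.min (d / 2) (Num.min 1 (Num.min (L^-1) (A / B / 2))).
have h0 : 0 < h by rewrite !lt_min !divr_gt0// invr_gt0 L0 ltr01.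
have [hd [h1 [hL hA]]] : h <= d / 2 /\ h <= 1 /\ h <= L^-1 /\ h <= A / B / 2.
  by rewrite /h !ge_min !lexx ?orbT.
have : A <= B * h.
  apply: le_trans (key h h0 _ h1 _) _; first by lra.
    by rewrite mulrC -ler_pdivlMr// div1r.
  rewrite ler_wpM2l ?(ltW B0)// -{2}[h]expr1 ler_wiXn2l ?(ltW h0) ?subn_gt0//.
rewrite mulrC -ler_pdivrMr// => AB.
have : 0 < A / B by rewrite divr_gt0.
lra.
Qed.

Lemma multiplicity_bilipschitz f g phi c x :
  (1 < size f)%N -> (1 < size g)%N -> bilipschitz_homeo phi -> c != 0 ->
  (forall y, g.[phi y] = c * f.[y]) ->
  multiplicity g (phi x) = multiplicity f x.
Proof.
move=> sf sg [psi [k1 k2 l1 l2]] c0 gphi; apply/eqP; rewrite eqn_leq.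
rewrite (multiplicity_lipschitz_le _ sf sg l1 c0 gphi) /= -{1}(k1 x).
apply: (multiplicity_lipschitz_le _ sg sf l2 (invr_neq0 c0)) => y.
by rewrite -{2}(k2 y) gphi mulKf.
Qed.

Lemma bilipschitz_monotone phi : bilipschitz_homeo phi ->
  {homo phi : x y / x < y} \/ {homo phi : x y /~ x < y}.
Proof.
move=> [psi [k1 _ l1 _]].
have [|||] := @itv_continuous_inj_mono _ phi `]-oo, +oo[.
- exact/continuous_subspaceT/lipschitz_continuous.
- by move=> x y _ _ /(can_inj k1).
- by move=> h; left=> x y; apply: h; rewrite in_itv.
- by move=> h; right=> x y; apply: h; rewrite in_itv.
Qed.

(** A strictly sorted sequence is determined by its elements, so it is enough
    that [phi] preserves being critical and is monotone. *)
Lemma bilipschitz_critical (p : nat) f g phi c (t s : p.-tuple R) :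
  (1 < size f)%N -> (1 < size g)%N -> bilipschitz_homeo phi -> c != 0 ->
  (forall y, g.[phi y] = c * f.[y]) ->
  critical_points f t -> critical_points g s ->
  map phi t = s \/ map phi (rev t) = s.
Proof.
move=> sf sg bphi c0 gphi [st tP] [ss sP].
have crit x : (phi x \in s) = (x \in t).
  apply/idP/idP => [/sP/eqP|/tP/eqP].
    rewrite critical_multiplicity// (multiplicity_bilipschitz _ sf sg bphi c0 gphi).
    by rewrite -critical_multiplicity// => /eqP/tP.
  rewrite critical_multiplicity// -(multiplicity_bilipschitz _ sf sg bphi c0 gphi).
  by rewrite -critical_multiplicity// => /eqP/sP.
have mem (r : seq R) : r =i t -> map phi r =i s.
  move=> rt y; have [psi [k1 k2 _ _]] := bphi.
  by rewrite -{2}(k2 y) crit -rt -{1}(k2 y) (mem_map (can_inj k1)).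
have eqs (r : seq R) : r =i t -> sorted <%R (map phi r) -> map phi r = s.
  by move=> rt sr; apply: lt_sorted_eq => //; exact: mem.
case: (bilipschitz_monotone bphi) => h; [left|right]; apply: eqs => //.
- exact: homo_sorted st.
- by move=> x; rewrite mem_rev.
rewrite sorted_map rev_sorted; apply: sub_sorted st => x y xy /=; exact: h.
Qed.

End LipschitzHomeo.

(** * Corresponding intervals between critical points *)

Section Cells.
Variables (R : realType) (p : nat).
Implicit Types (f g : {poly R}) (t s : 'I_p -> R) (x y : R).

(** The points [t i] cut the line into points and open intervals, and so do the
    [s i]; the signs record in which of these pieces a point lies. *)
Definition same_cell t s x y := forall i, Num.sg (x - t i) = Num.sg (y - s i).

Lemma same_cell_sym t s x y : same_cell t s x y -> same_cell s t y x.
Proof. by move=> h i; rewrite h. Qed.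

Lemma same_cell_le t s x y i : same_cell t s x y -> (x <= t i) = (y <= s i).
Proof. by move=> h; rewrite -subr_le0 -sgr_le0 h sgr_le0 subr_le0. Qed.

Lemma same_cell_lt t s x y i : same_cell t s x y -> (x < t i) = (y < s i).
Proof. by move=> h; rewrite -subr_lt0 -sgr_lt0 h sgr_lt0 subr_lt0. Qed.

Lemma same_cell_ge t s x y i : same_cell t s x y -> (t i <= x) = (s i <= y).
Proof. by move=> h; rewrite !leNgt (same_cell_lt i h). Qed.

Lemma same_cell_gt t s x y i : same_cell t s x y -> (t i < x) = (s i < y).
Proof. by move=> h; rewrite !ltNge (same_cell_le i h). Qed.

Definition enumerates_critical f t :=
  injective t /\ forall x, f^`().[x] = 0 <-> exists i, x = t i.

Lemma mup_factor (P : {poly R}) (r : seq R) : P != 0 -> uniq r ->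
  exists2 q : {poly R}, (forall a, a \in r -> q.[a] != 0) &
    P = q * \prod_(a <- r) ('X - a%:P) ^+ mup a P.
Proof.
move=> P0; elim: r => [_|a r IH /= /andP[ar /IH[q qr e]]].
  by exists P; rewrite ?big_nil ?mulr1.
have q0 : q != 0 by apply: contraNneq P0 => q0; rewrite e q0 mul0r.
have [m [q']] := multiplicity_XsubC q a; rewrite q0 /= => q'a eq.
have ra : ~~ root (\prod_(b <- r) ('X - b%:P) ^+ mup b P) a.
  rewrite rootE horner_prod prodf_seq_neq0; apply/allP => b br /=.
  rewrite horner_exp expf_neq0// hornerXsubC subr_eq0.
  by apply: contraNneq ar => ->.
have ma : mup a P = m by rewrite e mupMl// eq mupMr// mup_XsubCX eqxx.
exists q'; last by rewrite big_cons ma mulrA -eq.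
move=> b; rewrite inE => /orP[/eqP->//|/qr]; rewrite eq hornerM mulf_eq0.
by rewrite negb_or => /andP[].
Qed.

(** The sign of the derivative is read off from this factorization, since the
    cofactor [q] keeps a constant sign; its growth rate is known as well. *)
Lemma deriv_factor f t : (1 < size f)%N -> enumerates_critical f t ->
  exists2 q : {poly R}, (forall x, q.[x] != 0) &
    f^`() = q * \prod_i ('X - (t i)%:P) ^+ (multiplicity f (t i)).-1.
Proof.
move=> sf [tI tP]; have f0 := deriv_neq0 sf.
have [|q qt e] := @mup_factor f^`() (map t (enum 'I_p)) f0.
  by rewrite map_inj_uniq ?enum_uniq.
have {}e : f^`() = q * \prod_i ('X - (t i)%:P) ^+ (multiplicity f (t i)).-1.
  rewrite {1}e big_map big_enum /=; congr (_ * _); apply: eq_bigr => i _.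
  by rewrite multiplicity_deriv.
exists q => // x; apply/eqP => qx.
have /tP[i xi] : f^`().[x] = 0 by rewrite e hornerM qx mul0r.
by move/eqP: qx; apply/negP; rewrite qt// xi map_f// mem_enum.
Qed.

Lemma sgr_deriv f t : (1 < size f)%N -> enumerates_critical f t ->
  exists2 e : R, e != 0 & forall x, Num.sg f^`().[x] =
    e * \prod_i Num.sg (x - t i) ^+ (multiplicity f (t i)).-1.
Proof.
move=> sf ft; have [q q0 e] := deriv_factor sf ft.
exists (Num.sg q.[0]); first by rewrite sgr_eq0.
move=> x; rewrite e hornerM horner_prod sgrM (big_morph Num.sg (@sgrM R) (@sgr1 R)).
congr (_ * _); last first.
  by apply: eq_bigr => i _; rewrite horner_exp hornerXsubC sgrX.
have qN : {in `]-oo, +oo[, forall y, ~~ root q y} by move=> y _; rewrite rootE.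
by apply: (polyrN0_itv qN); rewrite in_itv.
Qed.

Lemma deriv_same_cell f t x y : (1 < size f)%N -> enumerates_critical f t ->
  same_cell t t x y -> Num.sg f^`().[x] = Num.sg f^`().[y].
Proof.
move=> sf ft xy; have [e _ h] := sgr_deriv sf ft.
by rewrite !h; congr (_ * _); apply: eq_bigr => i _; rewrite xy.
Qed.

Lemma deriv_neq0_noncritical f t x :
  enumerates_critical f t -> (forall i, x != t i) ->
  f^`().[x] != 0.
Proof.
by move=> [_ ft] xt; apply/eqP => /ft[i xi]; have := xt i; rewrite xi eqxx.
Qed.

(** The consequences of an equality of symbols from which the homeomorphism is
    built.  They are symmetric in the two polynomials, so that each statement
    about [phi] also applies to its inverse. *)
Record matched f t g s : Prop := Matched {
  matched_gt1 : (1 < size f)%N;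
  matched_size : size f = size g;
  matched_critl : enumerates_critical f t;
  matched_critr : enumerates_critical g s;
  matched_cell : forall i, same_cell t s (t i) (s i);
  matched_val : forall i, f.[t i] = g.[s i];
  matched_mult : forall i, multiplicity f (t i) = multiplicity g (s i);
  matched_deriv : forall x y, same_cell t s x y ->
    Num.sg f^`().[x] = Num.sg g^`().[y] }.

Lemma matched_sym f t g s : matched f t g s -> matched g s f t.
Proof.
move=> [h1 h2 h3 h4 h5 h6 h7 h8]; split => //; first by rewrite -h2.
- by move=> i; exact: same_cell_sym.
- by move=> x y xy; rewrite (h8 y x)//; exact: same_cell_sym.
Qed.

(** The graph of the homeomorphism [phi] with [g (phi x) = f x] that maps each
    [t i] to [s i]. *)
Definition corresponds f t g s x y := same_cell t s x y /\ g.[y] = f.[x].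

Lemma corresponds_sym f t g s x y :
  corresponds f t g s x y -> corresponds g s f t y x.
Proof. by move=> [h1 h2]; split => //; exact: same_cell_sym. Qed.

(** Either a critical point separates the two abscissae, and then its image
    separates the ordinates, or [f] and [g] are both strictly monotone, in the
    same direction, on the intervals concerned. *)
Lemma corresponds_lt f t g s x y x' y' : matched f t g s ->
  corresponds f t g s x y -> corresponds f t g s x' y' -> x < x' -> y < y'.
Proof.
move=> m [c e] [c' e'] xx'.
have [/existsP[i /andP[xi ix']]|/existsPn N] :=
    boolP [exists i, (x <= t i) && (t i <= x')].
  have yi : y <= s i by rewrite -(same_cell_le i c).
  have iy' : s i <= y' by rewrite -(same_cell_ge i c').
  rewrite lt_neqAle (le_trans yi iy') andbT; apply/eqP => yy'.
  have : s i <= y by rewrite yy'.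
  rewrite -(same_cell_ge i c) => ix.
  have : y' <= s i by rewrite -yy'.
  by rewrite -(same_cell_le i c') => x'i; lra.
(* No critical point lies between [x] and [x']: compare mean value points. *)
have [z zI fz] := poly_mvt f xx'.
have [xz zx'] : x < z /\ z < x' by rewrite !(itvP zI).
have fz0 : f^`().[z] != 0.
  apply: (deriv_neq0_noncritical (matched_critl m)) => i; apply: contraTneq (N i) => <-.
  by rewrite negbK !ltW.
rewrite ltNge; apply/negP; rewrite le_eqVlt => /orP[/eqP yy'|yy'].
  move: fz; rewrite -e -e' yy' subrr => /esym/eqP.
  by rewrite mulf_eq0 (negPf fz0) subr_eq0 gt_eqF.
have [w wI gw] := poly_mvt g yy'.
have [yw wy'] : y' < w /\ w < y by rewrite !(itvP wI).
have cz : same_cell t s z w.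
  move=> i; have := N i; rewrite negb_and -!ltNge => /orP[ix|x'i].
    have : t i < x' by exact: lt_trans xx'.
    rewrite (same_cell_gt i c') => iy'.
    by rewrite !gtr0_sg// subr_gt0; [exact: lt_trans yw|exact: lt_trans xz].
  have : x < t i by exact: lt_trans x'i.
  rewrite (same_cell_lt i c) => yi.
  by rewrite !ltr0_sg// subr_lt0; [exact: lt_trans yi|exact: lt_trans x'i].
rewrite e e' in gw.
have fx : f.[x'] - f.[x] = - (g^`().[w] * (y - y')) by rewrite -gw opprB.
move: fx; rewrite fz => /(congr1 Num.sg); rewrite sgrN !sgrM.
rewrite !(@gtr0_sg _ (_ - _)) ?subr_gt0// !mulr1 (matched_deriv m cz) => h.
have : Num.sg g^`().[w] = 0 by move: h; lra.
by rewrite -(matched_deriv m cz) => /eqP; rewrite sgr_eq0 (negPf fz0).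
Qed.

Lemma corresponds_inj f t g s x y y' : matched f t g s ->
  corresponds f t g s x y -> corresponds f t g s x y' -> y = y'.
Proof.
move=> m /corresponds_sym a /corresponds_sym a'; have m' := matched_sym m.
by case: (ltgtP y y') => // h; have := corresponds_lt m' _ _ h; move=> /(_ x x);
  rewrite ltxx => H; exfalso; apply: notF; apply: H.
Qed.

End Cells.

(** * Existence of corresponding points *)

Section Existence.
Variables (R : realType) (p : nat).
Implicit Types (f g : {poly R}) (t s : 'I_p -> R) (x y : R).

Lemma horner_unbounded f A : (1 < size f)%N ->
  exists M, forall x, M <= `|x| -> A < `|f.[x]|.
Proof.
move=> sf; have f0 : f != 0 by rewrite -size_poly_gt0 ltnW.
have [c c0 [M fM]] := horner_lower f0.
exists (Num.max M (A / c)) => x; rewrite ge_max => /andP[/fM h Ac].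
apply: lt_le_trans h; rewrite mulrC -ltr_pdivrMr//; apply: (le_lt_trans Ac).
rewrite (@lt_le_trans _ _ (1 + `|x|))// ?ltrDr// -{1}[1 + _]expr1.
by rewrite ler_weXn2l ?lerDl// -ltnS prednK// ltnW.
Qed.

Lemma sgr_same_side (d a b : R) : d ^+ 2 = 1 -> 0 < d * a -> 0 < d * b ->
  Num.sg a = Num.sg b.
Proof.
move=> d2 da db; have h c : 0 < d * c -> Num.sg c = Num.sg d.
  move=> dc; have -> : c = d * (d * c) by rewrite mulrA -expr2 d2 mul1r.
  by rewrite sgrM (gtr0_sg dc) mulr1.
by rewrite !h.
Qed.

Lemma mvt_toward f (d a b : R) : d ^+ 2 = 1 -> 0 < d * (b - a) ->
  exists c, [/\ 0 < d * (c - a), 0 < d * (b - c) &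
    f.[b] - f.[a] = f^`().[c] * (b - a)].
Proof.
move=> /eqP; rewrite sqrf_eq1 => /orP[/eqP->|/eqP->].
  rewrite mul1r subr_gt0 => /(poly_mvt f)[c cI e]; exists c.
  by rewrite !mul1r !subr_gt0 !(itvP cI).
rewrite mulN1r opprB subr_gt0 => /(poly_mvt f)[c cI e]; exists c.
by rewrite !mulN1r !opprB !subr_gt0 !(itvP cI) -(opprB a b) mulrN -e opprB.
Qed.

Lemma far_point s (d : R) : d ^+ 2 = 1 ->
  exists b, forall i, 0 < d * (b - s i).
Proof.
move=> d2; exists (d * (1 + \sum_i `|s i|)) => i.
rewrite mulrBr mulrA -expr2 d2 mul1r subr_gt0.
have nd : `|d| = 1.
  by move/eqP: d2; rewrite sqrf_eq1 => /orP[]/eqP->; rewrite ?normrN normr1.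
have : d * s i <= `|s i| by rewrite (le_trans (ler_norm _))// normrM nd mul1r.
have : `|s i| <= \sum_j `|s j| by rewrite (bigD1 i)//= lerDl sumr_ge0.
lra.
Qed.

(** The end, in direction [d = 1] or [d = -1], of the interval for [g] that
    corresponds to the interval of [x] for [f]: the nearest critical point of
    [g], or else a point far enough for [g] to have passed the value [f x].
    The sign condition at both ends lets the intermediate value theorem
    produce a point where [g] takes the value [f x].  Treating both directions
    at once avoids repeating the argument. *)
Lemma cell_end f t g s x (d : R) : d ^+ 2 = 1 -> matched f t g s ->
  (forall i, x != t i) ->
  exists l, [/\ 0 < Num.sg f^`().[x] * (d * (g.[l] - f.[x])),
    forall i, 0 < d * (t i - x) -> 0 <= d * (s i - l),
    forall i, 0 < d * (x - t i) -> 0 < d * (l - s i) &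
    (exists2 i, 0 < d * (t i - x) & l = s i) \/ forall i, 0 < d * (x - t i)].
Proof.
move=> d2 m xt; have fx0 := deriv_neq0_noncritical (matched_critl m) xt.
have d0 : d != 0 by rewrite -sqrf_eq0 d2 oner_eq0.
have side i : 0 < d * (t i - x) \/ 0 < d * (x - t i).
  have : d * (t i - x) != 0 by rewrite mulf_neq0// subr_eq0 eq_sym.
  rewrite -(opprB (t i) x) mulrN oppr_gt0 neq_lt => /orP[]; first by right.
  by left.
have pos a e : Num.sg f^`().[x] = Num.sg a -> 0 < d * e ->
    0 < Num.sg f^`().[x] * (d * (a * e)).
  move=> xa de; rewrite (_ : _ * _ = (Num.sg f^`().[x] * a) * (d * e)); last by ring.
  by rewrite mulr_gt0// xa -normrEsg normr_gt0 -sgr_eq0 -xa sgr_eq0.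
have ts i j : Num.sg (d * (t i - t j)) = Num.sg (d * (s i - s j)).
  by rewrite !sgrM (matched_cell m).
have same (u : 'I_p -> R) c : (forall i, 0 < d * (t i - x) -> 0 < d * (u i - c)) ->
    (forall i, 0 < d * (x - t i) -> 0 < d * (c - u i)) -> same_cell t u x c.
  move=> h1 h2 i; case: (side i) => h; last exact: sgr_same_side d2 h (h2 i h).
  by rewrite -(opprB (t i)) -(opprB (u i)) !sgrN (sgr_same_side d2 h (h1 i h)).
(* If [none] holds, the interval of [x] is unbounded in direction [d]. *)
have [i0 hi0|none] := pickP (fun i => 0 < d * (t i - x)); last first.
  have neg i : 0 < d * (x - t i).
    by case: (side i) => //; rewrite none.
  have [b sb] := far_point s d2.
  (* Beyond this bound the increment of [g] from [b], whose sign is that of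
     its derivative, outweighs [g b] and [f x]. *)
  have [M gM] := @horner_unbounded g (2 * `|g.[b]| + `|f.[x]|)
    (matched_gt1 (matched_sym m)).
  pose l := d * (`|M| + 1 + `|b|).
  have nd : `|d| = 1.
    by move/eqP: d2; rewrite sqrf_eq1 => /orP[]/eqP->; rewrite ?normrN normr1.
  have bl : 0 < d * (l - b).
    rewrite mulrBr mulrA -expr2 d2 mul1r subr_gt0.
    have : d * b <= `|b| by rewrite (le_trans (ler_norm _))// normrM nd mul1r.
    have := normr_ge0 M; lra.
  have /gM big : M <= `|l|.
    rewrite normrM nd mul1r ger0_norm ?addr_ge0//.
    by have := ler_norm M; have := normr_ge0 b; lra.
  have [c [c1 _ gc]] := mvt_toward g d2 bl.
  have xc : same_cell t s x c.
    apply: same => i; first by rewrite none.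
    by have := sb i; move: c1; rewrite !mulrBr; lra.
  exists l; split; last by right.
  - have := pos _ _ (matched_deriv m xc) bl; rewrite -gc.
    have [e en E] : exists2 e : R, `|e| = 1 & forall z,
        Num.sg f^`().[x] * (d * z) = e * z.
      exists (Num.sg f^`().[x] * d) => [|z]; last by rewrite mulrA.
      by rewrite normrM nd normr_sg fx0 mulr1.
    rewrite !E => h; have : e * (g.[l] - g.[b]) = `|g.[l] - g.[b]|.
      by rewrite -(gtr0_norm h) normrM en mul1r.
    have := lerB_dist g.[l] g.[b].
    have : - `|g.[b] - f.[x]| <= e * (g.[b] - f.[x]).
      rewrite lerNl -mulrN (le_trans (ler_norm _))// normrM en mul1r normrN//.
    have := ler_normB g.[b] f.[x].
    by move: big; rewrite !mulrBr; lra.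
  - by move=> i; rewrite none.
  - by move=> i _; have := sb i; move: bl; rewrite !mulrBr; lra.
case: (@arg_minP _ _ _ i0 (fun i => 0 < d * (t i - x)) (fun i => d * t i) hi0)
  => i hi imin.
have [c [c1 c2 fc]] := mvt_toward f d2 hi.
have near j : 0 < d * (t j - x) -> 0 <= d * (t j - t i).
  by move=> /imin; rewrite mulrBr subr_ge0.
have xc : same_cell t t x c.
  apply: same => j h; last by move: c1 h; rewrite !mulrBr; lra.
  by have := near j h; move: c2; rewrite !mulrBr; lra.
exists (s i); split; last by left; exists i.
- rewrite -(matched_val m) fc; apply: pos => //.
  exact: deriv_same_cell (matched_gt1 m) (matched_critl m) xc.
- by move=> j /near; rewrite -sgr_ge0 ts sgr_ge0.
- move=> j h; have : 0 < d * (t i - t j) by move: hi h; rewrite !mulrBr; lra.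
  by rewrite -sgr_gt0 ts sgr_gt0.
Qed.

Lemma corresponds_exists f t g s x : matched f t g s -> (0 < p)%N ->
  exists y, corresponds f t g s x y.
Proof.
move=> m p0.
have [/existsP[i /eqP->]|/existsPn xt] := boolP [exists i, x == t i].
  by exists (s i); split; [exact: matched_cell m _|rewrite (matched_val m)].
have N1 : (-1 : R) ^+ 2 = 1 by rewrite sqrrN expr1n.
have P1 : (1 : R) ^+ 2 = 1 by rewrite expr1n.
have [l [fl Pl Ql El]] := cell_end N1 m xt.
have [u [fu Pu Qu Eu]] := cell_end P1 m xt.
have lu : l < u.
  case: El => [[i xi ->]|none].
    by have := Qu i; rewrite !mul1r !subr_gt0; apply; move: xi; rewrite mulN1r; lra.
  case: Eu => [[i xi ->]|none'].
    by have := Ql i (none i); rewrite mulN1r; lra.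
  by have := none (Ordinal p0); have := none' (Ordinal p0); lra.
have [|y yI /rootP] := @poly_ivtoo _ (g - (f.[x])%:P) l u (ltW lu).
  rewrite !hornerE; move: fl fu; case: (sgrP f^`().[x]) => _; nra.
rewrite !hornerE => /eqP; rewrite subr_eq0 => /eqP gy.
have [ly yu] : l < y /\ y < u by rewrite !(itvP yI).
exists y; split=> // i; have := xt i; rewrite neq_lt => /orP[h|h].
  have := Pu i; rewrite !mul1r subr_gt0 subr_ge0 => /(_ h) su.
  by rewrite !ltr0_sg// subr_lt0// (lt_le_trans yu).
have := Pl i; rewrite !mulN1r !opprB subr_gt0 subr_ge0 => /(_ h) sl.
by rewrite !gtr0_sg// subr_gt0// (le_lt_trans sl).
Qed.

End Existence.

(** * Lipschitz estimates *)

Section LipschitzEstimates.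
Variables (R : realType) (p : nat).
Implicit Types (f g : {poly R}) (t s : 'I_p -> R) (x y : R) (phi : R -> R).

(** For large [|x|], both sides have the size of the [d]-th root of
    [|f x| = |g (phi x)|], where [d] is the common degree. *)
Lemma growth_le_of_conj f g phi : (1 < size f)%N -> size f = size g ->
  (forall x, g.[phi x] = f.[x]) ->
  exists2 K, 0 < K & forall x, 1 + `|x| <= K * (1 + `|phi x|).
Proof.
move=> sf sfg gphi; have f0 : f != 0 by rewrite -size_poly_gt0 ltnW.
have [c c0 [M fM]] := horner_lower f0; have [C C0 gC] := horner_upper g.
have d0 : (0 < (size f).-1)%N by rewrite -ltnS prednK// ltnW.
rewrite -sfg in gC; set d := (size f).-1 in fM gC d0.
(* Since [1 <= K], also [C / c <= K ^+ d], which avoids taking roots. *)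
pose K := 1 + C / c; have K1 : 1 <= K by rewrite lerDl divr_ge0// ltW.
have K0 : 0 < K by rewrite (lt_le_trans ltr01).
exists (K + `|M|) => [|x]; first by rewrite ltr_wpDr.
have px1 : 1 <= 1 + `|phi x| by rewrite lerDl.
have px0 : 0 <= 1 + `|phi x| by rewrite addr_ge0.
have [/fM h|xM] := leP M `|x|.
  have : 1 + `|x| <= K * (1 + `|phi x|).
    rewrite -(@ler_pXn2r _ d)// ?nnegrE ?addr_ge0//; last first.
      by rewrite mulr_ge0// ltW.
    rewrite exprMn (@le_trans _ _ (C / c * (1 + `|phi x|) ^+ d))//.
      rewrite mulrAC ler_pdivlMr// mulrC.
      by rewrite (le_trans h)// -gphi gC.
    rewrite ler_wpM2r ?exprn_ge0//.
    have : C / c <= K by rewrite lerDr.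
    by move/le_trans; apply; rewrite -{1}[K]expr1 ler_weXn2l.
  by move/le_trans; apply; rewrite ler_wpM2r// lerDl.
apply: (@le_trans _ _ (K + `|M|)).
  by have := ler_norm M; lra.
by rewrite ler_peMr// addr_ge0// ltW.
Qed.

(** With [m] the common multiplicity, [|x - x0| ^ m] and [|phi x - y0| ^ m] have
    the size of [|f x - f x0| = |g (phi x) - g y0|].  Where
    [1 < |phi x - y0|], a constant [K] with [d <= K] is enough. *)
Lemma dist_le_near f g x0 y0 phi : (1 < size f)%N -> (1 < size g)%N ->
  f.[x0] = g.[y0] -> multiplicity f x0 = multiplicity g y0 ->
  (forall x, g.[phi x] = f.[x]) ->
  exists2 d, 0 < d & exists2 K, 0 < K &
    forall x, `|x - x0| < d -> `|x - x0| <= K * `|phi x - y0|.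
Proof.
move=> sf sg fg mfg gphi.
have [u ux fu] := multiplicity_horner x0 sf.
have [v vy gv] := multiplicity_horner y0 sg.
rewrite -mfg -fg in gv.
have m0 : (0 < multiplicity f x0)%N by rewrite multiplicity_deriv.
set m := multiplicity f x0 in fu gv m0.
have [d d0 ud] := horner_away_near ux.
have [C C0 vC] := horner_bounded_near v y0.
have u0 : 0 < `|u.[x0]| by rewrite normr_gt0.
pose K := 1 + 2 * C / `|u.[x0]|.
have K1 : 1 <= K by rewrite lerDl divr_ge0// mulr_ge0// ltW.
have K0 : 0 < K by rewrite (lt_le_trans ltr01).
have lin (a b X Y : R) : a / 2 * X <= b * Y -> X * a <= 2 * b * Y by lra.
exists d => //; exists (K + d); first by rewrite addr_gt0.
move=> x xd; have p0 := normr_ge0 (phi x - y0).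
have [y1|y1] := leP `|phi x - y0| 1; last first.
  rewrite (le_trans (ltW xd))// (@le_trans _ _ (K + d))//; first by lra.
  by rewrite ler_peMr ?ltW// addr_gt0.
suff : `|x - x0| <= K * `|phi x - y0|.
  by move/le_trans; apply; rewrite ler_wpM2r// lerDl ltW.
rewrite -(@ler_pXn2r _ m) ?nnegrE ?mulr_ge0// ?(ltW K0)//.
have := fu x; rewrite -gphi gv => /(congr1 Num.norm); rewrite !normrM !normrX => e.
have h1 : `|u.[x0]| / 2 * `|x - x0| ^+ m <= C * `|phi x - y0| ^+ m.
  apply: (@le_trans _ _ (`|u.[x]| * `|x - x0| ^+ m)).
    by rewrite ler_wpM2r ?exprn_ge0// ud.
  by rewrite -e ler_wpM2r ?exprn_ge0// vC.
rewrite exprMn (@le_trans _ _ (2 * C / `|u.[x0]| * `|phi x - y0| ^+ m))//.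
  rewrite mulrAC ler_pdivlMr//.
  exact: lin h1.
rewrite ler_wpM2r ?exprn_ge0// (@le_trans _ _ K)// ?lerDr//.
by rewrite -{1}[K]expr1 ler_weXn2l.
Qed.

(** Near [t i] this is [dist_le_near].  Elsewhere [|phi x - s i|] is bounded
    below, because [phi] is monotone, and [|x|] is bounded by the growth
    estimate. *)
Lemma dist_critical_le f t g s phi i : matched f t g s ->
  (forall x, corresponds f t g s x (phi x)) ->
  exists2 K, 0 < K & forall x, `|x - t i| <= K * `|phi x - s i|.
Proof.
move=> m aphi; have gphi x : g.[phi x] = f.[x] by case: (aphi x).
have mono x y : x <= y -> phi x <= phi y.
  rewrite le_eqVlt => /orP[/eqP->//|xy].
  exact/ltW/(corresponds_lt m (aphi x) (aphi y)).
have phit : phi (t i) = s i.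
  apply: (corresponds_inj m (aphi _)); split; first exact: matched_cell m _.
  by rewrite (matched_val m).
have sf := matched_gt1 m; have sg := matched_gt1 (matched_sym m).
have [d d0 [K1 K10 near]] :=
  dist_le_near sf sg (matched_val m i) (matched_mult m i) gphi.
have [K2 K20 grow] := growth_le_of_conj sf (matched_size m) gphi.
have l : phi (t i - d) < s i.
  rewrite -phit; apply: (corresponds_lt m (aphi _) (aphi _)); lra.
have r : s i < phi (t i + d).
  rewrite -phit; apply: (corresponds_lt m (aphi _) (aphi _)); lra.
pose e := Num.min (s i - phi (t i - d)) (phi (t i + d) - s i).
have e0 : 0 < e by rewrite lt_min !subr_gt0 l r.
pose A := K2 * (1 + `|s i|) + `|t i|.
have A0 : 0 <= A by rewrite addr_ge0// mulr_ge0 ?addr_ge0// ltW.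
have Ae0 : 0 <= A / e by rewrite divr_ge0// ltW.
exists (K1 + (K2 + A / e)) => [|x]; first by lra.
have [/near h|xd] := ltP `|x - t i| d.
  by rewrite (le_trans h)// ler_wpM2r//; lra.
have pe : e <= `|phi x - s i|.
  move: xd; rewrite ler_normr => /orP[h|h].
    have : phi (t i + d) <= phi x by apply: mono; lra.
    have : e <= phi (t i + d) - s i by rewrite ge_min lexx orbT.
    by have := ler_norm (phi x - s i); lra.
  have : phi x <= phi (t i - d) by apply: mono; lra.
  have : e <= s i - phi (t i - d) by rewrite ge_min lexx.
  by have := ler_norm (s i - phi x); rewrite distrC; lra.
have h1 : `|x - t i| <= `|x| + `|t i| by exact: ler_normB.
have h2 : `|phi x| <= `|phi x - s i| + `|s i|.
  by rewrite -{1}[phi x](subrK (s i)) ler_normD.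
have h3 : K2 * `|phi x| <= K2 * (`|phi x - s i| + `|s i|).
  by rewrite ler_wpM2l// ltW.
have h4 : A <= A / e * `|phi x - s i|.
  by rewrite mulrAC ler_pdivlMr// ler_wpM2l.
have h5 := grow x; have h6 : 0 <= K1 * `|phi x - s i|.
  by rewrite mulr_ge0// ltW.
rewrite /A in h4 *; lra.
Qed.

(** In the factorizations of [f'] and [g'], the linear factors compare by
    [dist_critical_le] and the rootless cofactors, which have the same degree,
    by the growth estimate. *)
Lemma deriv_le_of_corresponds f t g s phi : matched f t g s ->
  (forall x, corresponds f t g s x (phi x)) ->
  exists2 K, 0 < K & forall x, `|f^`().[x]| <= K * `|g^`().[phi x]|.
Proof.
move=> m aphi; have gphi x : g.[phi x] = f.[x] by case: (aphi x).
have sf := matched_gt1 m; have sg := matched_gt1 (matched_sym m).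
have [K1 K10 grow] := growth_le_of_conj sf (matched_size m) gphi.
have [i|Ki KiP] := @choice _ _ (fun i K => 0 < K /\
    forall x, `|x - t i| <= K * `|phi x - s i|).
  by have [K K0 h] := dist_critical_le i m aphi; exists K.
have [q q0 fq] := deriv_factor sf (matched_critl m).
have [r r0 gr] := deriv_factor sg (matched_critr m).
have mm : \prod_i ('X - (s i)%:P) ^+ (multiplicity g (s i)).-1 =
          \prod_i ('X - (s i)%:P) ^+ (multiplicity f (t i)).-1 :> {poly R}.
  by apply: eq_bigr => i _; rewrite (matched_mult m).
rewrite {}mm in gr; set k := fun i => (multiplicity f (t i)).-1 in fq gr.
have monic (a : 'I_p -> R) : \prod_i ('X - (a i)%:P) ^+ k i \is monic.
  by apply: rpred_prod => i _; rewrite monic_exp// monicXsubC.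
have szprod (a : 'I_p -> R) :
    size (\prod_i ('X - (a i)%:P) ^+ k i) = (\sum_i k i).+1.
  rewrite size_prod_seq//; last by move=> i _; rewrite expf_neq0// polyXsubC_eq0.
  under eq_bigr do rewrite size_exp_XsubC -addn1.
  by rewrite big_split /= sum1_size -addSn addnK.
have qr : size q = size r.
  have nz (h : {poly R}) : (forall x, h.[x] != 0) -> h != 0.
    by move=> h0; apply: contraNneq (h0 0) => ->; rewrite horner0.
  have : size f^`() = size g^`() by rewrite !size_deriv (matched_size m).
  by rewrite fq gr !size_Mmonic ?nz// !szprod !addnS /= => /addIn.
have [C C0 qC] := horner_upper q; have [c c0 rc] := rootless_lower r0.
rewrite -qr in rc; set e := (size q).-1 in qC rc.
exists (C * K1 ^+ e / c * \prod_i (Ki i ^+ k i)) => [|x].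
  rewrite mulr_gt0// ?divr_gt0 ?mulr_gt0 ?exprn_gt0//.
  by apply: prodr_gt0 => i _; rewrite exprn_gt0//; case: (KiP i).
rewrite fq gr !hornerM !normrM !horner_prod !normr_prod.
rewrite mulrACA ler_pM ?prodr_ge0//; first last.
- rewrite -big_split /=; apply: ler_prod => i _; rewrite normr_ge0 /=.
  rewrite !horner_exp !hornerXsubC !normrX -exprMn.
  by case: (KiP i) => [Ki0 h]; rewrite lerXn2r ?nnegrE ?mulr_ge0// ltW.
apply: le_trans (qC x) _.
rewrite -!mulrA ler_wpM2l ?(ltW C0)//.
apply: (@le_trans _ _ ((K1 * (1 + `|phi x|)) ^+ e)).
  by rewrite lerXn2r ?nnegrE ?addr_ge0 ?mulr_ge0 ?addr_ge0// ltW.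
rewrite exprMn ler_wpM2l ?exprn_ge0 ?(ltW K10)//.
by rewrite mulrC ler_pdivlMr// mulrC.
Qed.

(** The finite set [r] is where nothing is known of the derivative; the mean
    value inequality is applied on the intervals that it cuts out. *)
Lemma lipschitz_of_derive phi (r : seq R) K : continuous phi ->
  (forall x, x \notin r -> exists2 l, is_derive x 1 phi l & `|l| <= K) ->
  lipschitz phi.
Proof.
move=> cphi dphi; apply/lipschitzP; exists K.
suff bound : forall (r' : seq R) a b, a < b ->
    (forall x, a < x < b -> x \notin r' ->
      exists2 l, is_derive x 1 phi l & `|l| <= K) ->
    `|phi b - phi a| <= K * (b - a).
  move=> x y; wlog xy : x y / x < y => [wl|].
    case: (ltgtP x y) => [|yx|->]; [exact: wl| |by rewrite !subrr !normr0 mulr0].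
    by rewrite distrC (distrC x); exact: wl.
  rewrite distrC (distrC x) [X in _ * X]gtr0_norm ?subr_gt0//.
  by apply: (bound r) => // z _; exact: dphi.
elim=> [|c r' IH] a b ab D.
  have [x|l lP] := @choice _ _ (fun x l => a < x < b ->
      is_derive x 1 phi l /\ `|l| <= K).
    have [/D[//|l l1 l2]|_] := boolP (a < x < b); first by exists l.
    by exists 0.
  have [||z zI ->] := @MVT _ phi l a b ab.
  - by move=> x; rewrite in_itv /= => /lP[].
  - exact: continuous_subspaceT.
  rewrite in_itv /= in zI; have [_ lK] := lP z zI.
  by rewrite normrM (gtr0_norm (_ : 0 < b - a)) ?subr_gt0// ler_wpM2r// subr_ge0 ltW.
have [/andP[ac cb]|ncI] := boolP (a < c < b).
  have -> : phi b - phi a = (phi b - phi c) + (phi c - phi a) by ring.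
  have -> : K * (b - a) = K * (b - c) + K * (c - a) by ring.
  rewrite (le_trans (ler_normD _ _))// lerD// IH// => x /andP[x1 x2] xr.
    apply: D; first by rewrite x2 (lt_trans ac).
    by rewrite inE negb_or xr gt_eqF.
  apply: D; first by rewrite x1 (lt_trans x2).
  by rewrite inE negb_or xr lt_eqF.
apply: IH => // x xI xr; apply: D => //; rewrite inE negb_or xr andbT.
by apply: contraNneq ncI => <-.
Qed.

Lemma diff_quotient f a :
  exists2 F : {poly R}, F.[a] = f^`().[a] &
    forall y, f.[y] - f.[a] = F.[y] * (y - a).
Proof.
have /factor_theorem[F e] : root (f - (f.[a])%:P) a.
  by rewrite rootE !hornerE subrr.
exists F => [|y].
  have -> : f^`() = (f - (f.[a])%:P)^`() by rewrite derivB derivC subr0.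
  by rewrite e derivM derivXsubC !hornerE subrr mulr0 add0r.
by move/(congr1 (horner^~ y)): e; rewrite !hornerE.
Qed.

(** Writing [f y - f x = F y * (y - x)] and
    [g z - g (phi x) = G z * (z - phi x)], the difference quotient of [phi] is
    [F y / G (phi y)], whose limit follows from continuity alone. *)
Lemma is_derive_implicit f g phi x : continuous phi ->
  (forall y, g.[phi y] = f.[y]) -> g^`().[phi x] != 0 ->
  is_derive x 1 phi (f^`().[x] / g^`().[phi x]).
Proof.
move=> cphi gphi gx0.
have [F Fx fF] := diff_quotient f x; have [G Gx gG] := diff_quotient g (phi x).
rewrite -Fx -Gx in gx0 *.
have cGphi : {for x, continuous (fun y => G.[phi y])}.
  by apply: (@continuous_comp _ _ _ phi); [exact: cphi|exact: continuous_horner].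
have cq : {for x, continuous (fun y => F.[y] / G.[phi y])}.
  by apply: cvgM; [exact: continuous_horner|exact: cvgV].
have lim : ((fun h => h^-1 *: ((phi \o shift x) (h *: (1 : R)) - phi x)) @ 0^'
    --> F.[x] / G.[phi x])%classic.
  move/continuous_withinNshiftx: cq; apply: cvg_trans.
  move/continuous_withinNshiftx: cGphi => cGphi.
  apply: near_eq_cvg; near=> h.
  have h0 : h != 0 by near: h; exact: nbhs_dnbhs_neq.
  have G0 : G.[phi (h + x)] != 0 by near: h; exact: cvgr_neq0 cGphi gx0.
  rewrite /= [h *: 1]mulr1 [_ *: _]mulrC; apply/eqP; rewrite eqr_div//.
  have := gG (phi (h + x)); rewrite !gphi fF addrK => ->.
  by rewrite mulrC.
apply: DeriveDef; first by apply/cvg_ex; exists (F.[x] / G.[phi x]).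
exact: cvg_lim.
Unshelve. all: by end_near. Qed.

Lemma increasing_can_continuous phi psi : cancel phi psi -> cancel psi phi ->
  {homo phi : x y / x < y} -> {homo psi : x y / x < y} -> continuous phi.
Proof.
move=> k1 k2 m1 m2 x; apply/cvgrPdist_lt => e e0.
have l : psi (phi x - e) < x by rewrite -{2}(k1 x) m2// ltrBlDr ltrDl.
have r : x < psi (phi x + e) by rewrite -{1}(k1 x) m2// ltrDl.
near=> y; rewrite ltr_distlC; apply/andP; split.
  by rewrite -(k2 (_ - _)) m1//; near: y; exact: lt_nbhsr.
by rewrite -(k2 (_ + _)) m1//; near: y; exact: lt_nbhsl.
Unshelve. all: by end_near. Qed.

End LipschitzEstimates.

(** * Polynomials with equal symbols *)

Section MatchedPolynomials.
Variables (R : realType) (p : nat).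
Implicit Types (f g : {poly R}).

Lemma corresponds_lipschitz f g (t s : 'I_p -> R) phi psi : matched f t g s ->
  cancel phi psi -> cancel psi phi ->
  (forall x, corresponds f t g s x (phi x)) ->
  (forall y, corresponds g s f t y (psi y)) ->
  lipschitz phi.
Proof.
move=> m k1 k2 aphi apsi.
have gphi x : g.[phi x] = f.[x] by case: (aphi x).
have cphi : continuous phi.
  apply: (increasing_can_continuous k1 k2) => x y.
    exact: corresponds_lt m (aphi x) (aphi y).
  exact: corresponds_lt (matched_sym m) (apsi x) (apsi y).
have [K K0 fK] := deriv_le_of_corresponds m aphi.
apply: (@lipschitz_of_derive _ _ (codom t) K) => // x xt.
have fx0 : f^`().[x] != 0.
  apply: (deriv_neq0_noncritical (matched_critl m)) => i.
  by apply: contraNneq xt => ->; exact: codom_f.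
have gx0 : g^`().[phi x] != 0.
  by rewrite -sgr_eq0 -(matched_deriv m (aphi x).1) sgr_eq0.
exists (f^`().[x] / g^`().[phi x]); first exact: is_derive_implicit.
by rewrite normrM normfV ler_pdivrMr ?normr_gt0.
Qed.

Lemma matched_lipschitz_equiv f g (t s : 'I_p -> R) : (0 < p)%N ->
  matched f t g s -> lipschitz_equiv (horner f) (horner g).
Proof.
move=> p0 m; have m' := matched_sym m.
have [phi aphi] := choice (fun x => corresponds_exists x m p0).
have [psi apsi] := choice (fun y => corresponds_exists y m' p0).
have k1 : cancel phi psi.
  by move=> x; apply: (corresponds_inj m' (apsi _)); exact: corresponds_sym.
have k2 : cancel psi phi.
  by move=> x; apply: (corresponds_inj m (aphi _)); exact: corresponds_sym.
exists phi; last by exists 1 => // x; rewrite mul1r; case: (aphi x).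
exists psi; split => //; first exact: corresponds_lipschitz m k1 k2 aphi apsi.
exact: corresponds_lipschitz m' k2 k1 apsi aphi.
Qed.

Lemma critical_points_tnth f (t : p.-tuple R) : critical_points f t ->
  enumerates_critical f (tnth t).
Proof.
move=> [st tP]; split; first by apply/tuple_uniqP; exact: lt_sorted_uniq st.
by move=> x; rewrite -tP; split=> [/tnthP|[i ->]]; last exact: mem_tnth.
Qed.

(** Comparing with the sign of a difference of indices makes all strictly
    sorted tuples of the same length indistinguishable. *)
Lemma sorted_tnth (t : p.-tuple R) i j : sorted <%R t ->
  Num.sg (tnth t i - tnth t j) = Num.sg (i%:R - j%:R).
Proof.
move=> st; have lt (a b : 'I_p) : (a < b)%N -> tnth t a < tnth t b.
  move=> ab; rewrite !(tnth_nth 0).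
  by rewrite lt_sorted_ltn_nth// inE size_tuple.
case: (ltngtP i j) => ij.
- by rewrite !ltr0_sg// subr_lt0 ?lt// ltr_nat.
- by rewrite !gtr0_sg// subr_gt0 ?lt// ltr_nat.
by rewrite (val_inj ij) !subrr.
Qed.

(** The condition on the signs of the derivatives is the only one that is not
    immediate.  The two signs differ by a factor [a / b] that does not depend on
    the interval, and it is determined on the interval between the first two
    critical points, where [f] and [g] have the same increment. *)
Lemma direct_matched f g (t s : p.-tuple R) : (1 < p)%N ->
  (1 < size f)%N -> size f = size g ->
  critical_points f t -> critical_points g s ->
  mult_symbol f t = mult_symbol g s -> matched f (tnth t) g (tnth s).
Proof.
move=> p1 sf sfg tP sP [e1 e2]; have sg : (1 < size g)%N by rewrite -sfg.
have ct := critical_points_tnth tP; have cs := critical_points_tnth sP.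
have cell i : same_cell (tnth t) (tnth s) (tnth t i) (tnth s i).
  by move=> j; rewrite !sorted_tnth//; [case: sP|case: tP].
have val i : f.[tnth t i] = g.[tnth s i].
  have := congr1 (fun u => nth 0 u i) e1.
  by rewrite !(nth_map 0) ?size_tuple// -!tnth_nth.
have mult i : multiplicity f (tnth t i) = multiplicity g (tnth s i).
  have := congr1 (fun u => nth 0%N u i) e2.
  by rewrite !(nth_map 0) ?size_tuple// -!tnth_nth.
split=> // x y.
have [a a0 fa] := sgr_deriv sf ct; have [b b0 gb] := sgr_deriv sg cs.
have prod_eq z w : same_cell (tnth t) (tnth s) z w ->
    \prod_i Num.sg (z - tnth t i) ^+ (multiplicity f (tnth t i)).-1 =
    \prod_i Num.sg (w - tnth s i) ^+ (multiplicity g (tnth s i)).-1.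
  by move=> zw; apply: eq_bigr => i _; rewrite zw mult.
suff ab : a = b by move=> xy; rewrite fa gb (prod_eq x y)// ab.
pose i0 := Ordinal (ltnW p1); pose i1 := Ordinal p1.
have lt01 (u : p.-tuple R) : sorted <%R u -> tnth u i0 < tnth u i1.
  by move=> su; rewrite -subr_gt0 -sgr_gt0 sorted_tnth// subr0 sgr1.
have between (u : p.-tuple R) z (i : 'I_p) :
    sorted <%R u -> z \in `]tnth u i0, tnth u i1[ ->
    Num.sg (z - tnth u i) = if i == i0 then 1 else -1.
  move=> su zI; have [z0 z1] : tnth u i0 < z /\ z < tnth u i1 by rewrite !(itvP zI).
  have [->|ii0] := eqVneq i i0; first by rewrite gtr0_sg ?subr_gt0.
  have i1i : (i1 <= i)%N by rewrite lt0n; apply: contra_neq ii0 => ?; exact: val_inj.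
  have : tnth u i1 <= tnth u i.
    by rewrite -subr_ge0 -sgr_ge0 sorted_tnth// sgr_ge0 subr_ge0 ler_nat.
  by move=> ui; rewrite ltr0_sg// subr_lt0 (lt_le_trans z1).
have [z zI fz] := poly_mvt f (lt01 t tP.1).
have [w wI gw] := poly_mvt g (lt01 s sP.1).
have zw : same_cell (tnth t) (tnth s) z w.
  by move=> i; rewrite (between t)// ?(between s)//; [case: sP|case: tP].
have fz0 : f^`().[z] != 0.
  apply: (deriv_neq0_noncritical ct) => i; rewrite -subr_eq0 -sgr_eq0 (between t) ?tP.1//.
  by case: ifP; rewrite ?oppr_eq0 oner_eq0.
have : Num.sg f^`().[z] = Num.sg g^`().[w].
  move: fz; rewrite !val gw => /(congr1 Num.sg); rewrite !sgrM.
  by rewrite !(@gtr0_sg _ (_ - _)) ?mulr1 ?subr_gt0 ?lt01//; [case: tP|case: sP].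
rewrite fa gb (prod_eq z w zw) => /mulIf; apply.
apply: contraNneq fz0 => h; rewrite -sgr_eq0 fa (prod_eq z w zw) h mulr0//.
Qed.

End MatchedPolynomials.

(** * Similar symbols *)

Section Similarity.
Variables (R : realType) (p : nat).
Implicit Types (f g : {poly R}) (t s : p.-tuple R).

Lemma bilipschitz_id : bilipschitz_homeo (id : R -> R).
Proof.
have l : lipschitz (id : R -> R) by apply/lipschitzP; exists 1 => x y; rewrite mul1r.
by exists id.
Qed.

(** Passing from [f] to [c f] makes the symbols equal. *)
Lemma direct_lipschitz_equiv f g t s : (1 < p)%N ->
  (1 < size f)%N -> size f = size g ->
  critical_points f t -> critical_points g s ->
  directly_similar (mult_symbol f t) (mult_symbol g s) ->
  lipschitz_equiv (horner f) (horner g).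
Proof.
move=> p1 sf sfg [st tP] sP [[c c0 ea] em].
have cN0 : c != 0 by rewrite gt_eqF.
have scf : size (c *: f) = size f by rewrite size_scale.
have tcP : critical_points (c *: f) t.
  split=> // x; rewrite tP derivZ hornerZ; split=> [->|/eqP]; first by rewrite mulr0.
  by rewrite mulf_eq0 (negPf cN0) => /eqP.
have symb : mult_symbol (c *: f) t = mult_symbol g s.
  congr pair; apply: val_inj => /=.
    have /= -> := congr1 val ea; rewrite -map_comp.
    by apply: eq_map => x /=; rewrite hornerZ.
  have /= -> := congr1 val em; apply: eq_map => x /=.
  apply: (multiplicity_bilipschitz x sf _ bilipschitz_id cN0); first by rewrite scf.
  by move=> y; rewrite hornerZ.
have sc1 : (1 < size (c *: f))%N by rewrite scf.
have scg : size (c *: f) = size g by rewrite scf.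
have [phi bphi [k k0 gphi]] :=
  matched_lipschitz_equiv (ltnW p1) (direct_matched p1 sc1 scg tcP sP symb).
exists phi => //; exists (k * c); first by rewrite mulr_gt0.
by move=> x; rewrite gphi hornerZ mulrA.
Qed.

Lemma horner_reflect f x : (f \Po - 'X).[x] = f.[- x].
Proof. by rewrite horner_comp !hornerE. Qed.

Lemma size_reflect f : size (f \Po - 'X) = size f.
Proof. by rewrite size_comp_poly2// size_polyN size_polyX. Qed.

Lemma reflect_critical_points f t : critical_points f t ->
  critical_points (f \Po - 'X) [tuple of rev (map -%R t)].
Proof.
move=> [st tP]; split=> [|x] /=.
  rewrite rev_sorted sorted_map; apply: sub_sorted st => x y /=.
  by rewrite ltrN2.
rewrite mem_rev -{1}[x]opprK mem_map; last exact: oppr_inj.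
rewrite tP deriv_comp derivN derivX hornerM horner_reflect hornerN hornerC mulrN1.
by split=> [->|/eqP]; rewrite ?oppr0// oppr_eq0 => /eqP.
Qed.

(** The reflection is bi-Lipschitz, hence preserves multiplicities. *)
Lemma reflect_mult_symbol f t : (1 < size f)%N ->
  mult_symbol (f \Po - 'X) [tuple of rev (map -%R t)] =
  ([tuple of rev (mult_symbol f t).1], [tuple of rev (mult_symbol f t).2]).
Proof.
move=> sf; congr pair; apply: val_inj => /=; rewrite map_rev -map_comp; congr rev;
  apply: eq_map => x /=; first by rewrite horner_reflect opprK.
apply: (multiplicity_bilipschitz x sf _ (bilipschitz_opp R) (oner_neq0 R)).
  by rewrite size_reflect.
by move=> y; rewrite horner_reflect opprK mul1r.
Qed.

Lemma reverse_lipschitz_equiv f g t s : (1 < p)%N ->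
  (1 < size f)%N -> size f = size g ->
  critical_points f t -> critical_points g s ->
  reversely_similar (mult_symbol f t) (mult_symbol g s) ->
  lipschitz_equiv (horner f) (horner g).
Proof.
move=> p1 sf sfg tP sP [[c c0 ea] em].
have sim : directly_similar
    (mult_symbol (f \Po - 'X) [tuple of rev (map -%R t)]) (mult_symbol g s).
  by rewrite reflect_mult_symbol//; split=> //; exists c.
have sr : (1 < size (f \Po - 'X))%N by rewrite size_reflect.
have srg : size (f \Po - 'X) = size g by rewrite size_reflect.
have [phi bphi [k k0 gphi]] :=
  direct_lipschitz_equiv p1 sr srg (reflect_critical_points tP) sP sim.
exists (phi \o -%R); first exact: bilipschitz_comp bphi (bilipschitz_opp R).
by exists k => // x /=; rewrite gphi horner_reflect opprK.
Qed.

Lemma lipschitz_equiv_similar f g t s :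
  (1 < size f)%N -> (1 < size g)%N ->
  critical_points f t -> critical_points g s ->
  lipschitz_equiv (horner f) (horner g) ->
  symbols_similar (mult_symbol f t) (mult_symbol g s).
Proof.
move=> sf sg tP sP [phi bphi [c c0 gphi]].
have cN0 : c != 0 by rewrite gt_eqF.
have vals (r : seq R) : map (horner g) (map phi r) = map ( *%R c) (map (horner f) r).
  by rewrite -!map_comp; apply: eq_map => x /=; rewrite gphi.
have mults (r : seq R) : map (multiplicity g) (map phi r) = map (multiplicity f) r.
  rewrite -!map_comp; apply: eq_map => x /=.
  exact: multiplicity_bilipschitz bphi cN0 gphi.
have [e|e] := bilipschitz_critical sf sg bphi cN0 gphi tP sP; [left|right].
  split; last by apply: val_inj; rewrite /= -e mults.
  by exists c => //; apply: val_inj; rewrite /= -e vals.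
split; last by apply: val_inj; rewrite /= -e mults map_rev.
by exists c => //; apply: val_inj; rewrite /= -e vals [map _ (rev t)]map_rev.
Qed.

End Similarity.

Theorem proposition3 (R : realType) (d p : nat) (f g : {poly R})
    (t s : p.-tuple R) :
  (1 <= d)%N -> (2 <= p)%N ->
  size f = d.+1 -> size g = d.+1 ->
  critical_points f t -> critical_points g s ->
  lipschitz_equiv (horner f) (horner g) <->
  symbols_similar (mult_symbol f t) (mult_symbol g s).
Proof.
move=> d1 p2 sf sg tP sP.
have sf1 : (1 < size f)%N by rewrite sf.
have sg1 : (1 < size g)%N by rewrite sg.
have sfg : size f = size g by rewrite sf sg.
split; first exact: lipschitz_equiv_similar.
by case; [exact: direct_lipschitz_equiv|exact: reverse_lipschitz_equiv].
Qed.
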